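(* Let $Y=(Y(x):x\ge 0)$ be a real-valued Markov process and let $0<a<b<\infty$. Fix a state $H_0\in\mathcal{H}$ and let $0\le T<\bar{T}(H_0)$. Then $$V_1(H_0,T)=\inf_{\lambda>0}\bigl(V(H_0,\lambda)+\lambda T\bigr).$$
   Context: **Histories.** $\mathcal{H}=\bigcup_{T=0}^\infty(\mathbb{R}_+\times\mathbb{R})^T$ is the space of histories. A history is regarded as a finite (unordered) set of pairs $(x,y)$, where $(x,y)$ records the observation $Y(x)=y$. Conditioning on $H\in\mathcal{H}$ means conditioning on $Y(x)=y$ for all $(x,y)\in H$. **Policies.** A (deterministic) policy is a measurable function $\pi:\mathcal{H}\to\mathbb{R}_+\cup\{\Delta\}$; $\Delta$ means ''stop''. $\Pi$ is the set of all such policies. A randomized policy is a measurable function $\pi:[0,1]\times\mathcal{H}\to\mathbb{R}_+\cup\{\Delta\}$; $\Pi_R$ is the set of all randomized policies. (Deterministic policies are viewed as randomized policies not depending on the first argument.) Starting from an initial history $H_0$, a policy generates $x_{t+1}=\pi(H_t)$ (deterministic) or $x_{t+1}=\pi(U,H_t)$ (randomized), where $U\sim\mathrm{Uniform}([0,1])$ is drawn once at time $0$, independently of $Y$, and held fixed over time. Then $H_{t+1}=H_t\cup\{(x_{t+1},Y(x_{t+1}))\}$ if $x_{t+1}\neq\Delta$ and $H_{t+1}=H_t$ if $x_{t+1}=\Delta$ (sampling a point already in the history leaves the history unchanged). The number of samples $\tau$ is the first $t\ge 0$ at which the policy's decision based on $H_t$ is $\Delta$ ($\infty$ if there is none). $\mathbb{P}^\pi(\cdot\mid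 H)$ and $\mathbb{E}^\pi[\cdot\mid H]$ denote the law and expectation under policy $\pi$ started from initial history $H$. **Reward.** $I$ is a finite index set, and for $i\in I$, $f_i:\mathbb{R}\to\mathbb{R}$ is a bounded measurable function with $\int_{[a,b]}\mathbb{E}[|f_i(Y(x))|]\,dx<\infty$. For $H\in\mathcal{H}$, $$R_{[a,b]}(H)=\int_{[a,b]}\max_{i\in I}\mathbb{E}[f_i(Y(x))\mid H]\,dx.$$ **Performance and value functions.** For $\lambda>0$ and a policy $\pi$, $\mathrm{Per}(\pi,\lambda,H)=\mathbb{E}^\pi[R_{[a,b]}(H_\tau)-\lambda\tau\mid H]$, which equals $-\infty$ if $\mathbb{P}^\pi(\tau=\infty\mid H)>0$. The cost-per-sample value is $V(H,\lambda)=\sup_{\pi\in\Pi}\mathrm{Per}(\pi,\lambda,H)$. For $T\ge0$, with $\Pi_1(H,T)=\{\pi\in\Pi_R:\mathbb{E}^\pi[\tau\mid H]=T\}$, the expected-budget-constrained value is $$V_1(H,T)=\sup_{\pi\in\Pi_1(H,T)}\mathbb{E}^\pi[R_{[a,b]}(H_\tau)\mid H].$$ **The threshold $\bar T(H)$.** For $\lambda>0$ and $\epsilon>0$ let $$\Pi^*_\epsilon(\lambda)=\{\pi\in\Pi_R:\ \mathrm{Per}(\pi,\lambda,H)\ge V(H,\lambda)-\epsilon\ \text{ for all }H\in\mathcal{H}\}.$$ Let $$s(\lambda,H)=\lim_{\epsilon\to0^+}\ \sup\{\mathbb{E}^\pi[\tau\mid H]:\pi\in\Pi^*_\epsilon(\lambda)\}$$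 and $$\bar{T}(H)=\lim_{\lambda\to0^+}s(\lambda,H)\in[0,\infty].$$ *)

(* Defs.v *)
From HB Require Import structures.
From mathcomp Require Import all_boot all_order all_algebra finmap.
From mathcomp Require Import all_classical all_reals all_analysis.
From mathcomp Require Import measurable_realfun.

Set Implicit Arguments.
Unset Strict Implicit.
Unset Printing Implicit Defensive.

Import Order.TTheory GRing.Theory Num.Theory.
Import numFieldNormedType.Exports.

Local Open Scope classical_set_scope.
Local Open Scope ring_scope.

(* The sigma-algebra of the half-line is the trace of the Borel sets of R. *)
Definition Rplus (R : realType) : Type := {nonneg R}.

HB.instance Definition _ (R : realType) := Choice.on (Rplus R).
HB.instance Definition _ (R : realType) :=
  isPointed.Build (Rplus R) (0%R%:nng : {nonneg R}).

Definition Rplus_val (R : realType) (x : Rplus R) : R := (x : {nonneg R})%:num.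

(* Identity on the half-line; the values at negative reals are never used. *)
Definition to_Rplus (R : realType) (x : R) : Rplus R := (`|x|%:nng)%R.

Definition Rplus_display : measure_display. Proof. exact. Qed.

Section Rplus_measurable.
Context (R : realType).

Definition Rplus_measurable : set (set (Rplus R)) :=
  preimage_set_system setT (@Rplus_val R) (@measurable _ (measurableTypeR R)).

Let sigmaR : sigma_algebra setT Rplus_measurable.
Proof. exact/sigma_algebra_preimage/sigma_algebra_measurable. Qed.

Let Rplus0 : Rplus_measurable set0. Proof. by case: sigmaR. Qed.

Let RplusC A : Rplus_measurable A -> Rplus_measurable (~` A).
Proof. by case: sigmaR => _ + _ => /[apply]; rewrite setTD. Qed.

Let Rplus_bigcup (F : (set (Rplus R))^nat) :
  (forall i, Rplus_measurable (F i)) -> Rplus_measurable (\bigcup_i F i).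
Proof. by case: sigmaR => _ _; apply. Qed.

HB.instance Definition _ := @isMeasurable.Build Rplus_display (Rplus R)
  Rplus_measurable Rplus0 RplusC Rplus_bigcup.

End Rplus_measurable.

(* Disjoint union of T with an isolated point: [None] is the action "stop". *)
Definition option_display : measure_display -> measure_display.
Proof. exact. Qed.

Section option_measurable.
Context (d : measure_display) (T : measurableType d).

Definition option_measurable : set (set (option T)) :=
  [set A | measurable (Some @^-1` A)].

Let option0 : option_measurable set0. Proof. exact: measurable0. Qed.

Let optionC A : option_measurable A -> option_measurable (~` A).
Proof. exact: measurableC. Qed.

Let option_bigcup (F : (set (option T))^nat) :
  (forall i, option_measurable (F i)) -> option_measurable (\bigcup_i F i).
Proof.
by move=> mF; rewrite /option_measurable /= preimage_bigcup;
  exact: bigcupT_measurable.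
Qed.

HB.instance Definition _ := @isMeasurable.Build (option_display d) (option T)
  option_measurable option0 optionC option_bigcup.

End option_measurable.

(* Histories are finite sets of observations (x, y).  A set of histories is
   measurable iff, for every n, its inverse image in (Rplus * R)^n under
   (p_1, ..., p_n) |-> {p_1, ..., p_n} is: this is the quotient of the
   sigma-algebra of the disjoint union of the powers (Rplus * R)^n. *)
Definition history (R : realType) : Type := {fset (Rplus R * R)}.

HB.instance Definition _ (R : realType) := Choice.on (history R).
HB.instance Definition _ (R : realType) :=
  isPointed.Build (history R) (fset0 : {fset (Rplus R * R)}).

Definition history_of (R : realType) (n : nat) (t : n.-tuple (Rplus R * R)) :
  history R := [fset p in tval t]%fset.

Definition history_display : measure_display. Proof. exact. Qed.

Section history_measurable.
Context (R : realType).

Definition history_measurable : set (set (history R)) :=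
  [set A | forall n, measurable (@history_of R n @^-1` A)].

Let history0 : history_measurable set0.
Proof. by move=> n; rewrite preimage_set0; exact: measurable0. Qed.

Let historyC A : history_measurable A -> history_measurable (~` A).
Proof.
move=> mA n; rewrite preimage_setC.
exact: (@measurableC _ (n.-tuple (Rplus R * R)) _ (mA n)).
Qed.

Let history_bigcup (F : (set (history R))^nat) :
  (forall i, history_measurable (F i)) -> history_measurable (\bigcup_i F i).
Proof.
by move=> mF n; rewrite preimage_bigcup; apply: bigcupT_measurable => i;
  exact: mF.
Qed.

HB.instance Definition _ := @isMeasurable.Build history_display (history R)
  history_measurable history0 historyC history_bigcup.

End history_measurable.

Definition observe (R : realType) (x : Rplus R) (y : R) (H : history R) :
  history R := ((x, y) |` H)%fset.

Section process.
Context (R : realType) (d : measure_display) (Omega : measurableType d).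

(* h is a version of the conditional probability P(A | G), for a
   sub-sigma-algebra G. *)
Definition is_cond_prob (P : probability Omega R) (G : set (set Omega))
    (A : set Omega) (h : Omega -> \bar R) : Prop :=
  [/\ forall B : set (\bar R), measurable B -> G (h @^-1` B),
      P.-integrable setT h &
      forall C, G C -> (\int[P]_(w in C) h w = P (A `&` C))%E].

Definition sigma_of (X : Omega -> R) : set (set Omega) :=
  preimage_set_system setT X measurable.

Definition sigma_past (Y : Rplus R -> Omega -> R) (s : Rplus R) :
    set (set Omega) :=
  <<s [set A | exists2 r, Rplus_val r <= Rplus_val s & sigma_of (Y r) A] >>.

(* Almost surely, P(Y(t) \in B | Y(r), r <= s) = P(Y(t) \in B | Y(s)). *)
Definition markov_process (P : probability Omega R)
    (Y : Rplus R -> Omega -> R) : Prop :=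
  forall (s t : Rplus R), Rplus_val s <= Rplus_val t ->
  forall B : set R, measurable B ->
  forall h g : Omega -> \bar R,
    is_cond_prob P (sigma_past Y s) (Y t @^-1` B) h ->
    is_cond_prob P (sigma_of (Y s)) (Y t @^-1` B) g ->
    {ae P, forall w, h w = g w}.

(* Exactly what makes Y(X) a random variable for every random time X. *)
Definition measurable_process (Y : Rplus R -> Omega -> R) : Prop :=
  measurable_fun setT (fun z : Rplus R * Omega => Y z.1 z.2).

Definition agree (Y : Rplus R -> Omega -> R) (H : history R) : set Omega :=
  [set w | forall p, p \in (H : {fset (Rplus R * R)}) -> Y p.1 w = p.2].

(* Q H is the conditional law P(. | H), for every history H at once.  An
   elementary conditional probability given H is in general undefined, the
   event [agree Y H] being negligible, so Q is a regular version, coherent in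
   the sense that conditioning Q H on the value of Y(x) amounts to adding the
   observation (x, Y(x)) to H.  When no path agrees with H (for instance if H
   contains two values for one x), Q H cannot be concentrated on
   [agree Y H] = set0 and is only required to be coherent. *)
Record conditional_laws (P : probability Omega R) (Y : Rplus R -> Omega -> R)
    (Q : history R -> probability Omega R) : Prop := {
  cond_measurable : forall A, measurable A ->
    measurable_fun setT (fun H => Q H A) ;
  cond_nothing : forall A, measurable A -> Q (fset0 : {fset _}) A = P A ;
  cond_agree : forall H, agree Y H !=set0 -> Q H (agree Y H) = 1%E ;
  cond_coherent : forall H x A, measurable A ->
    is_cond_prob (Q H) (sigma_of (Y x)) A
      (fun w => Q (observe x (Y x w) H) A) }.

End process.

(* The first argument is the randomization variable U.  Only its values in
   [0, 1] matter: a measurable function on [0, 1] * history is the restriction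
   of a measurable function on R * history. *)
Definition policy (R : realType) : Type := R -> history R -> option (Rplus R).

Definition Pi_R (R : realType) : set (policy R) :=
  [set p | measurable_fun setT (fun z : R * history R => p z.1 z.2)].

Definition Pi (R : realType) : set (policy R) :=
  [set p | exists2 q : history R -> option (Rplus R),
             measurable_fun setT q & p = fun=> q].

Section sampling.
Context (R : realType) (d : measure_display) (Omega : measurableType d).
Variable Y : Rplus R -> Omega -> R.

Fixpoint run (p : policy R) (H : history R) (z : R * Omega) (t : nat) :
    history R :=
  if t is t'.+1 then
    let Ht := run p H z t' in
    if p z.1 Ht is Some x then observe x (Y x z.2) Ht else Ht
  else H.

Definition stops (p : policy R) (H : history R) (z : R * Omega) : set nat :=
  [set t | p z.1 (run p H z t) = None].

(* The infimum of the empty set is +oo. *)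
Definition tau (p : policy R) (H : history R) (z : R * Omega) : \bar R :=
  ereal_inf [set t%:R%:E | t in stops p H z].

(* The history at time tau, with the dummy value H when tau = +oo. *)
Definition final_history (p : policy R) (H : history R) (z : R * Omega) :
    history R :=
  run p H z (xget 0%N [set t : nat | tau p H z = t%:R%:E]).

Variable Q : history R -> probability Omega R.

(* E^p[g | H]: U is uniform on [0, 1] and independent of the path of Y. *)
Definition Exp (H : history R) (g : R * Omega -> \bar R) : \bar R :=
  (\int[uniform_prob (@ltr01 R) \x Q H]_z g z)%E.

Variables (I : finType) (f : I -> R -> R) (a b : R).

Definition reward (H : history R) : \bar R :=
  (\int[lebesgue_measure]_(x in `[a, b])
     \big[maxe/-oo]_(i : I) 'E_(Q H)[f i \o Y (to_Rplus x)])%E.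

Definition Per (p : policy R) (lambda : R) (H : history R) : \bar R :=
  Exp H (fun z => reward (final_history p H z) - lambda%:E * tau p H z)%E.

Definition V (H : history R) (lambda : R) : \bar R :=
  ereal_sup [set Per p lambda H | p in @Pi R].

Definition Pi1 (H : history R) (T : R) : set (policy R) :=
  @Pi_R R `&` [set p | Exp H (tau p H) = T%:E].

Definition V1 (H : history R) (T : R) : \bar R :=
  ereal_sup [set Exp H (fun z => reward (final_history p H z)) | p in Pi1 H T].

Definition Pi_star (eps lambda : R) : set (policy R) :=
  @Pi_R R `&`
  [set p | forall H : history R, (V H lambda - eps%:E <= Per p lambda H)%E].

Definition sup_samples (lambda : R) (H : history R) : \bar R :=
  lim (ereal_sup [set Exp H (tau p H) | p in Pi_star eps lambda]
       @[eps --> 0^'+]).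

Definition Tbar (H : history R) : \bar R :=
  lim (sup_samples lambda H @[lambda --> 0^'+]).

End sampling.

(* Main.v *)
(* Write t and r for the mean sample number and the mean reward of a policy.
   Conditionally on U a randomized policy is deterministic, so by Fubini every
   linear inequality between t and r that holds for all deterministic policies
   holds for the randomized ones; this is weak duality, and it shows that V is
   also the supremum over randomized policies.  Conversely, following one of two
   deterministic policies according to whether U < theta realizes every point of
   the segment between their (t, r), so chords of the deterministic points pass
   below G = V_1(H_0, T) at T, and some line of slope lambda through (T, G)
   dominates all of them.  That lambda can be taken positive is where T < \bar T
   enters: for some lambda_0 > 0 there are lambda_0-optimal policies, up to any
   epsilon, with t > T; if r <= G + lambda (t - T) for all policies and
   lambda < lambda_0, these force V(H_0, lambda_0) + lambda_0 T <= G. *)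
From HB Require Import structures.
Require Import Defs.
From mathcomp Require Import all_boot all_order all_algebra finmap.
From mathcomp Require Import all_classical all_reals all_analysis.
From mathcomp Require Import measurable_realfun lra.
Import Order.TTheory GRing.Theory Num.Theory.
Import numFieldNormedType.Exports.
Local Open Scope classical_set_scope.
Local Open Scope ring_scope.

Set Implicit Arguments.
Unset Strict Implicit.
Unset Printing Implicit Defensive.

(** * Measurability of the sample number and of the final history *)

Lemma observe_history_of (R : realType) n (t : n.-tuple (Rplus R * R)) x y :
  observe x y (history_of t) = history_of [the n.+1.-tuple _ of (x, y) :: t].
Proof.
apply/fsetP => p; rewrite /observe /history_of !inE /=; reflexivity.
Qed.

Lemma history_of_enum (R : realType) (H : history R) :
  history_of (in_tuple (enum_fset H)) = H.
Proof. by apply/fsetP => p; rewrite /history_of inE /=. Qed.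

Lemma measurable_history_of (R : realType) n :
  measurable_fun setT (@history_of R n).
Proof. by move=> _ B mB; rewrite setTI; exact: mB. Qed.

Section run_measurable.
Context (R : realType) (d : measure_display) (Omega : measurableType d).
Variables (Y : Rplus R -> Omega -> R) (p : policy R) (H : history R).
Hypothesis mY : measurable_process Y.
Hypothesis mp : Pi_R p.

(* [run] adds at most one observation per step, so its length is random; [trace]
   has a deterministic length, which reduces measurability to that of tuples.
   The two agree only until the policy stops. *)
Fixpoint trace (z : R * Omega) (t : nat) :
    (t + size (enum_fset H)).-tuple (Rplus R * R) :=
  if t is t'.+1 then
    let x := odflt point (p z.1 (history_of (trace z t'))) in
    [the _.-tuple _ of (x, Y x z.2) :: trace z t']
  else in_tuple (enum_fset H).

(** This is the event [tau = t]; outside the union of these events [tau] is [+oo]. *)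
Definition stop_at (t : nat) : set (R * Omega) :=
  [set z | stops Y p H z t /\ forall s, (s < t)%N -> ~ stops Y p H z s].

(** No decision before time [t] is [None], so the default [point] in [trace] never enters. Time [t]
    itself may be a stop, since its decision affects only the next history. *)
Lemma run_trace z t : (forall s, (s < t)%N -> ~ stops Y p H z s) ->
  run Y p H z t = history_of (trace z t).
Proof.
elim: t => [|t IH] nstop; first by rewrite /= history_of_enum.
have {}IH : run Y p H z t = history_of (trace z t).
  by apply: IH => s st; apply: nstop; rewrite ltnS ltnW.
rewrite /= -IH; have := nstop t (leqnn _).
rewrite /stops /=; case: (p z.1 (run Y p H z t)) => // x _ /=.
by rewrite IH observe_history_of.
Qed.

Lemma stopsP z t : (forall s, (s < t)%N -> ~ stops Y p H z s) ->
  stops Y p H z t <-> p z.1 (history_of (trace z t)) = None.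
Proof. by move=> /run_trace e; rewrite /stops/= e. Qed.

Lemma measurable_odflt d' (T : measurableType d') (x : T) :
  measurable_fun setT (odflt x).
Proof.
move=> _ B mB; rewrite setTI; rewrite /measurable/= /option_measurable/=.
by rewrite -comp_preimage.
Qed.

Lemma measurable_None d' (T : measurableType d') :
  measurable [set None : option T].
Proof.
rewrite /measurable/= /option_measurable/=.
by rewrite (_ : _ @^-1` _ = set0)// -subset0.
Qed.

Lemma measurable_decision n (g : R * Omega -> n.-tuple (Rplus R * R)) :
  measurable_fun setT g ->
  measurable_fun setT (fun z => p z.1 (history_of (g z))).
Proof.
move=> mg.
apply: (@measurableT_comp _ _ _ _ _ _ (fun z : R * history R => p z.1 z.2) _
  (fun z => (z.1, history_of (g z))) mp).
apply: measurable_fun_pair => //.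
exact: (measurableT_comp (@measurable_history_of R n) mg).
Qed.

Lemma measurable_trace t : measurable_fun setT (trace ^~ t).
Proof.
elim: t => [|t IH] /=; first exact: measurable_cst.
have mx := measurableT_comp (measurable_odflt point) (measurable_decision IH).
apply: measurable_cons => //; apply: measurable_fun_pair => //.
pose g (z : R * Omega) := (odflt point (p z.1 (history_of (trace z t))), z.2).
apply: (@measurableT_comp _ _ _ _ _ _ (fun z => Y z.1 z.2) _ g mY).
exact: measurable_fun_pair.
Qed.

Definition trace_stops t : set (R * Omega) :=
  [set z | p z.1 (history_of (trace z t)) = None].

Lemma measurable_trace_stops t : measurable (trace_stops t).
Proof.
rewrite -[trace_stops t]setTI.
have := measurable_decision (@measurable_trace t).
by move=> /(_ measurableT [set None]); apply; exact: measurable_None.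
Qed.

(** [stops] and [trace_stops] can differ after the first stop, but by induction on [u] having no
    stop before [u] means the same for both. This expresses the event through sets already known to
    be measurable. *)
Lemma stop_atE t :
  stop_at t =
  trace_stops t `&` \bigcap_(s in [set s | (s < t)%N]) ~` trace_stops s.
Proof.
have nstop z u : (forall s, (s < u)%N -> ~ stops Y p H z s) <->
    (forall s, (s < u)%N -> ~ trace_stops s z).
  elim: u => [|u IH]; first by split.
  split => h s; rewrite ltnS leq_eqVlt => /orP[/eqP ->|su].
  - by move/stopsP => /(_ (fun s su => h s (ltnW su))); apply: h.
  - by apply IH => // r ru; apply: h; exact: ltnW.
  - rewrite stopsP; first exact: h.
    by apply IH => r ru; apply: h; exact: ltnW.
  - by apply (IH.2 (fun r ru => h r (ltnW ru))).
apply/seteqP; split => z /=.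
  by move=> [sz nz]; split; [exact/stopsP|exact/nstop].
by move=> [sz /nstop nz]; split => //; exact/stopsP.
Qed.

Lemma measurable_stop_at t : measurable (stop_at t).
Proof.
rewrite stop_atE; apply: measurableI; first exact: measurable_trace_stops.
apply: bigcap_measurableType => s _; apply: measurableC.
exact: measurable_trace_stops.
Qed.

Lemma tau_stop_at z t : stop_at t z -> tau Y p H z = t%:R%:E.
Proof.
move=> [st nst]; apply/eqP; rewrite eq_le; apply/andP; split.
  by apply: ereal_inf_lbound; exists t.
apply: le_ereal_inf_tmp => _ [s ss <-]; rewrite lee_fin ler_nat leqNgt.
by apply/negP => /nst.
Qed.

Lemma tau_never z : ~ (exists t, stop_at t z) -> tau Y p H z = +oo%E.
Proof.
move=> nz; rewrite /tau (_ : stops Y p H z = set0) ?image_set0 ?ereal_inf0//.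
rewrite -subset0 => t; elim/ltn_ind: t => t IH st; apply: nz.
by exists t; split.
Qed.

Lemma final_history_stop_at z t : stop_at t z ->
  final_history Y p H z = history_of (trace z t).
Proof.
move=> h; rewrite -run_trace; last by case: h.
(* [tau] determines the natural number sought by [xget], so the choice is forced. *)
rewrite /final_history; congr run; apply: xget_subset1 => /=.
  exact: tau_stop_at.
move=> m n /= /[swap]; rewrite (tau_stop_at h) => -[+] -[].
by move=> /eqP; rewrite eqr_nat => /eqP <- /eqP; rewrite eqr_nat => /eqP.
Qed.

Lemma final_history_never z : ~ (exists t, stop_at t z) ->
  final_history Y p H z = H.
Proof.
move=> /tau_never e; rewrite /final_history xgetPN// => t /=.
by rewrite e.
Qed.

(** The events [stop_at t] and the event [never] form a countable measurable cover, so measurability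
    can be checked on each of them. *)
Lemma measurable_stop_family d' (T : measurableType d')
    (g : R * Omega -> T) (gt : nat -> R * Omega -> T) (c : T) :
  (forall t, measurable_fun setT (gt t)) ->
  (forall z t, stop_at t z -> g z = gt t z) ->
  (forall z, ~ (exists t, stop_at t z) -> g z = c) ->
  measurable_fun setT g.
Proof.
move=> mgt gE gc.
pose never := ~` \bigcup_t stop_at t.
have mnever : measurable never.
  by apply: measurableC; apply: bigcupT_measurable; exact: measurable_stop_at.
have -> : setT = never `|` \bigcup_t stop_at t.
  by rewrite /never setUC setUv.
apply/measurable_funU => //.
  by apply: bigcupT_measurable; exact: measurable_stop_at.
split.
  apply: (eq_measurable_fun (cst c)); last exact: measurable_cst.
  move=> z; rewrite inE => nz; rewrite gc// => -[t tz]; apply: nz.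
  by exists t.
apply/measurable_fun_bigcup => t; first exact: measurable_stop_at.
apply: (eq_measurable_fun (gt t)).
  by move=> z; rewrite inE => /gE.
exact: measurable_funTS.
Qed.

Lemma measurable_tau : measurable_fun setT (tau Y p H).
Proof.
apply: (measurable_stop_family (gt := fun t => cst t%:R%:E) (c := +oo%E)).
- by move=> t; exact: measurable_cst.
- by move=> z t /tau_stop_at.
- by move=> z /tau_never.
Qed.

Lemma measurable_final_history (r : history R -> \bar R) :
  measurable_fun setT r ->
  measurable_fun setT (fun z => r (final_history Y p H z)).
Proof.
move=> mr.
apply: (measurable_stop_family (gt := fun t z => r (history_of (trace z t)))
  (c := r H)).
- move=> t; apply: (measurableT_comp mr).
  apply: (measurableT_comp (@measurable_history_of R _)).
  exact: measurable_trace.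
- by move=> z t /final_history_stop_at ->.
- by move=> z /final_history_never ->.
Qed.

End run_measurable.

(** * Measurability of integrals that depend on a parameter *)

Section kernel_integral.
Context d d' (X : measurableType d) (Z : measurableType d') (R : realType).
Variable l : X -> probability Z R.
Hypothesis ml : forall A, measurable A -> measurable_fun setT (fun x => l x A).

(** Carrying [ml] in the term lets the kernel structures be inferred from it. *)
Definition family_kernel of (forall A, measurable A ->
    measurable_fun setT (fun x => l x A)) :
  X -> {measure set Z -> \bar R} := fun x => l x.

HB.instance Definition _ := @isKernel.Build _ _ X Z R (family_kernel ml) ml.

Let family_kernel_prob x : family_kernel ml x [set: Z] = 1%E.
Proof. exact: probability_setT. Qed.

HB.instance Definition _ :=
  @Kernel_isProbability.Build _ _ X Z R (family_kernel ml) family_kernel_prob.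

(** Tonelli for kernels treats the positive and negative parts; their difference is measurable even
    where both integrals are infinite. *)
Lemma measurable_integral_family (k : X * Z -> \bar R) :
  measurable_fun setT k ->
  measurable_fun setT (fun x => \int[l x]_z k (x, z))%E.
Proof.
move=> mk.
rewrite (_ : (fun x => _) = (fun x => \int[family_kernel ml x]_z k (x, z))%E)//.
rewrite (_ : (fun x => _) = (fun x => \int[family_kernel ml x]_z k^\+ (x, z))
    \- (fun x => \int[family_kernel ml x]_z k^\- (x, z)))%E; last first.
  apply/funext => x; rewrite integralE; congr (_ - _)%E.
    by apply: eq_integral => z _; rewrite funepos_comp.
  by apply: eq_integral => z _; rewrite funeneg_comp.
apply: emeasurable_funB; apply: measurable_fun_integral_sfinite_kernel => //.
  exact: measurable_funepos.
exact: measurable_funeneg.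
Qed.

End kernel_integral.

Lemma measurable_fubini_integral d d' (X : measurableType d)
    (Z : measurableType d') (R : realType)
    (m : {sigma_finite_measure set Z -> \bar R}) (k : X * Z -> \bar R) :
  measurable_fun setT k ->
  measurable_fun setT (fun x => \int[m]_z k (x, z))%E.
Proof.
move=> mk.
rewrite (_ : (fun x => _) = (fun x => \int[m]_z k^\+ (x, z))
    \- (fun x => \int[m]_z k^\- (x, z)))%E; last first.
  apply/funext => x; rewrite integralE; congr (_ - _)%E.
    by apply: eq_integral => z _; rewrite funepos_comp.
  by apply: eq_integral => z _; rewrite funeneg_comp.
apply: emeasurable_funB.
  by apply: (@measurable_fun_fubini_tonelli_F _ _ _ _ _ _ (k^\+)%E) => //;
    exact: measurable_funepos.
by apply: (@measurable_fun_fubini_tonelli_F _ _ _ _ _ _ (k^\-)%E) => //;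
  exact: measurable_funeneg.
Qed.

Lemma measurable_bigmaxe d (X : measurableType d) (R : realType) (I : Type)
    (s : seq I) (g : I -> X -> \bar R) :
  (forall i, measurable_fun setT (g i)) ->
  measurable_fun setT (fun x => \big[maxe/-oo%E]_(i <- s) g i x).
Proof.
move=> mg; elim: s => [|i s IH].
  rewrite (_ : (fun x => _) = cst -oo%E); first exact: measurable_cst.
  by apply/funext => x; rewrite big_nil.
rewrite (_ : (fun x => _) =
    (fun x => maxe (g i x) (\big[maxe/-oo%E]_(i <- s) g i x))).
  exact: measurable_maxe.
by apply/funext => x; rewrite big_cons.
Qed.

(** * Measurability and boundedness of the reward *)

Lemma measurable_to_Rplus (R : realType) :
  measurable_fun [set: R] (@to_Rplus R).
Proof.
move=> _ B [A mA <-]; rewrite setTI setTI -comp_preimage.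
rewrite (_ : _ \o _ = @Num.norm R R)//.
by rewrite -[X in measurable X]setTI; exact: (@normr_measurable R setT).
Qed.

Lemma abse_leE (R : realType) (x : \bar R) (M : R) :
  (`|x| <= M%:E)%E = ((- M)%:E <= x <= M%:E)%E.
Proof.
by case: x => [r| |] /=; rewrite ?lee_fin ?ler_norml ?leye_eq ?leeNy_eq ?andbF.
Qed.

Lemma abs_integral_le d (X : measurableType d) (R : realType)
    (m : {measure set X -> \bar R}) (D : set X) (g : X -> \bar R) (M : R) :
  measurable D -> measurable_fun D g ->
  (forall x, D x -> `|g x| <= M%:E)%E ->
  (`|\int[m]_(x in D) g x| <= M%:E * m D)%E.
Proof.
move=> mD mg gM; apply: le_trans; first exact: le_abse_integral.
rewrite -integral_cst//; apply: ge0_le_integral => //.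
exact: measurableT_comp.
Qed.

Section reward.
Context (R : realType) (d : measure_display) (Omega : measurableType d).
Variables (Y : Rplus R -> Omega -> R) (Q : history R -> probability Omega R).
Variables (a b : R) (I : finType) (f : I -> R -> R).
Hypothesis mY : measurable_process Y.
Hypothesis mQ : forall A, measurable A -> measurable_fun setT (fun H => Q H A).
Hypothesis ab : a < b.
Hypothesis I_neq0 : (0 < #|I|)%N.
Hypothesis mf : forall i, measurable_fun setT (f i).
Hypothesis fbounded : forall i, exists M : R, forall y, `|f i y| <= M.

(** The integrand of [reward], taken jointly in history and point so that Fubini yields
    measurability in the history. *)
Let best (z : history R * R) : \bar R :=
  (\big[maxe/-oo]_(i : I) 'E_(Q z.1)[f i \o Y (to_Rplus z.2)])%E.

Let measurable_best : measurable_fun setT best.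
Proof.
apply: measurable_bigmaxe => i.
(* The kernel depends on the history alone; the point enters through the integrand. *)
pose l (z : history R * R) := Q z.1.
have ml A : measurable A -> measurable_fun setT (fun z => l z A).
  by move=> /mQ mA; exact: (measurableT_comp mA).
rewrite (_ : (fun z => _) = (fun z => \int[l z]_w
    ((f i (Y (to_Rplus (z, w).1.2) (z, w).2))%:E))%E); last first.
  by apply/funext => z; rewrite unlock.
apply: (measurable_integral_family ml (k := fun zw =>
  (f i (Y (to_Rplus zw.1.2) zw.2))%:E)).
apply/measurable_EFinP; apply: (measurableT_comp (mf i)).
pose g (zw : (history R * R) * Omega) := (to_Rplus zw.1.2, zw.2).
apply: (@measurableT_comp _ _ _ _ _ _ (fun z => Y z.1 z.2) _ g mY).
apply: measurable_fun_pair => //.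
apply: (measurableT_comp (@measurable_to_Rplus R)).
exact: measurableT_comp.
Qed.

Lemma measurable_reward : measurable_fun setT (reward Y Q f a b).
Proof.
rewrite (_ : reward _ _ _ _ _ = (fun H => \int[lebesgue_measure]_x
   (best \_ (setT `*` `[a, b])) (H, x)))%E; last first.
  apply/funext => H; rewrite /reward integral_mkcond.
  apply: eq_integral => x _; rewrite /patch.
  by congr (if _ then _ else _); apply/idP/idP; rewrite !inE //= => -[].
apply: measurable_fubini_integral.
apply/(measurable_restrictT _ _).1; first exact: measurableX.
exact: measurable_funTS.
Qed.

Lemma reward_bounded :
  exists2 C : R, 0 <= C & forall H, (`|reward Y Q f a b H| <= C%:E)%E.
Proof.
have [N NP] := choice fbounded.
(* Summing the absolute values gives one bound for all [f i]. *)
pose M : R := \sum_i `|N i|.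
have fM i y : `|f i y| <= M.
  rewrite (le_trans (NP i y))// (le_trans (ler_norm _))//.
  by rewrite /M (bigD1 i)//= lerDl sumr_ge0.
have M0 : 0 <= M by apply: sumr_ge0.
exists (M * (b - a)) => [|H].
  by rewrite mulr_ge0// subr_ge0 ltW.
apply: le_trans.
  apply: (@abs_integral_le _ _ _ _ _ _ M) => //.
    rewrite (_ : (fun x => _) = (fun x => best (H, x)))//.
    apply: (measurable_funTS (D := `[a, b])).
    by apply: (measurableT_comp measurable_best); exact: measurable_fun_pair.
  move=> x _.
  have EM i : (`|'E_(Q H)[f i \o Y (to_Rplus x)]| <= M%:E)%E.
    rewrite unlock -[leRHS]mule1 -(@probability_setT _ _ _ (Q H)).
    apply: abs_integral_le => //; last by move=> w _; exact: fM.
    apply/measurable_EFinP; apply: (measurableT_comp (mf i)).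
    pose g (w : Omega) := (to_Rplus x, w).
    apply: (@measurableT_comp _ _ _ _ _ _ (fun z => Y z.1 z.2) _ g mY).
    exact: measurable_fun_pair.
  rewrite abse_leE; apply/andP; split.
    (* An empty maximum would be [-oo]; the lower bound is read off one index. *)
    have [i _] : exists i, i \in I by apply/card_gt0P.
    apply: le_trans (le_bigmax _ _ i).
    by move: (EM i); rewrite abse_leE => /andP[].
  apply: (big_ind (fun z => (z <= M%:E)%E)).
  - by rewrite leNye.
  - by move=> u v uM vM; rewrite ge_max uM.
  - by move=> i _; apply: le_trans (EM i); exact: lee_abs.
by rewrite /= lebesgue_measure_itv /= lte_fin ab -EFinD -EFinM.
Qed.

End reward.

(** * Mean sample number and mean reward of a policy *)

Lemma integral_cst_prob d (X : measurableType d) (R : realType)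
    (m : probability X R) (c : \bar R) : (\int[m]_x c = c)%E.
Proof.
rewrite (integral_cst m measurableT c) -[RHS]mule1; congr (_ * _)%E.
exact: probability_setT.
Qed.

(** By Fubini the left side is an integral over [u] of the same combination of section integrals.
    Sections fail to be integrable only on a negligible set of [u], which is discarded; hence the
    bound is asked only at the other [u]. *)
Lemma fubini_linear_le d1 d2 (T1 : measurableType d1) (T2 : measurableType d2)
    (R : realType) (m1 : probability T1 R) (m2 : probability T2 R)
    (g h : T1 * T2 -> \bar R) (al be ga : R) :
  (m1 \x m2)%E.-integrable setT g -> (m1 \x m2)%E.-integrable setT h ->
  (forall u, m2.-integrable setT (fun w => g (u, w)) ->
     m2.-integrable setT (fun w => h (u, w)) ->
     (al%:E * (\int[m2]_w g (u, w)) + be%:E * (\int[m2]_w h (u, w))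
       <= ga%:E)%E) ->
  (al%:E * (\int[m1 \x m2]_z g z) + be%:E * (\int[m1 \x m2]_z h z)
    <= ga%:E)%E.
Proof.
move=> ig ih le_ga.
have [A [mA A0 subA]] := filterI (ae_integrable1 ig) (ae_integrable1 ih).
have iG := integrable_fubini_F ig; have iH := integrable_fubini_F ih.
rewrite -!integral12_prod_meas1// -!integralZl//.
rewrite -integralD//; [|exact: integrableZl..].
have iL : m1.-integrable setT (fun u => (al%:E * fubini_F m2 g u +
    be%:E * fubini_F m2 h u)%E).
  by apply: integrableD => //; exact: integrableZl.
have ic := finite_measure_integrable_cst m1 ga (@measurableT _ T1).
have ET : (ga%:E = \int[m1]_u (EFin \o cst ga) u)%E.
  exact: (esym (integral_cst_prob m1 ga%:E)).
rewrite ET (negligible_integral mA measurableT iL A0).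
rewrite (negligible_integral mA measurableT ic A0).
have mTA : measurable (setT `\` A) by exact: measurableD.
apply: le_integral => //.
- exact: (integrableS measurableT).
- exact: (integrableS measurableT).
- move=> u; rewrite inE => -[_ nAu] /=.
  have [gu hu] : m2.-integrable setT (fun w => g (u, w)) /\
      m2.-integrable setT (fun w => h (u, w)).
    by apply: contrapT => nu; apply: nAu; exact: subA.
  exact: le_ga.
Qed.

Section performance.
Context (R : realType) (d : measure_display) (Omega : measurableType d).
Variables (Y : Rplus R -> Omega -> R) (Q : history R -> probability Omega R).
Variables (rew : history R -> \bar R) (C : R) (H : history R).
Hypothesis mY : measurable_process Y.
Hypothesis mrew : measurable_fun setT rew.
Hypothesis C0 : 0 <= C.
Hypothesis rewC : forall h, (`|rew h| <= C%:E)%E.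

Let final (p : policy R) (z : R * Omega) : \bar R :=
  rew (final_history Y p H z).

Let U : probability (measurableTypeR R) R := uniform_prob (@ltr01 R).

(** Freezing the randomization at [u] leaves a deterministic policy, which ignores its own first
    argument; hence [u'] is arbitrary. *)
Lemma run_section (p : policy R) (u u' : R) (w : Omega) t :
  run Y p H (u, w) t = run Y (fun=> p u) H (u', w) t.
Proof. by elim: t => //= t ->. Qed.

Lemma tau_section (p : policy R) (u u' : R) (w : Omega) :
  tau Y p H (u, w) = tau Y (fun=> p u) H (u', w).
Proof.
rewrite /tau; congr (ereal_inf [set _ | t in _]).
by apply/funext => t; rewrite /stops/= (run_section _ _ u').
Qed.

Lemma final_section (p : policy R) (u u' : R) (w : Omega) :
  final p (u, w) = final (fun=> p u) (u', w).
Proof.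
rewrite /final /final_history (tau_section _ u u').
by rewrite (run_section _ _ u').
Qed.

Lemma tau_ge0 p z : (0 <= tau Y p H z)%E.
Proof. by apply: le_ereal_inf_tmp => _ [t _ <-]; rewrite lee_fin. Qed.

(** Integrability is not assumed, so Tonelli is applied to the positive and negative parts
    separately. *)
Lemma Exp_section (g : R * Omega -> \bar R) (u0 : R) :
  measurable_fun setT g -> (forall u w, g (u, w) = g (u0, w)) ->
  Exp Q H g = (\int[Q H]_w g (u0, w))%E.
Proof.
move=> mg gu.
have E (k : R * Omega -> \bar R) : measurable_fun setT k ->
    (forall z, 0 <= k z)%E -> (forall u w, k (u, w) = k (u0, w)) ->
    (\int[U \x Q H]_z k z = \int[Q H]_w k (u0, w))%E.
  move=> mk k0 ku; rewrite fubini_tonelli1//.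
  rewrite (eq_integral (fun=> \int[Q H]_w k (u0, w))%E).
    exact: integral_cst_prob.
  by move=> u _; apply: eq_integral => w _; rewrite ku.
rewrite /Exp integralE [RHS]integralE; congr (_ - _)%E.
- rewrite E//; [|exact: measurable_funepos|].
    by apply: eq_integral => w _; rewrite !funeposE.
  by move=> u w; rewrite !funeposE gu.
- rewrite E//; [|exact: measurable_funeneg|].
    by apply: eq_integral => w _; rewrite !funenegE.
  by move=> u w; rewrite !funenegE gu.
Qed.

Lemma deterministic_Pi_R (q : history R -> option (Rplus R)) :
  measurable_fun setT q -> @Pi_R R (fun=> q).
Proof. by move=> mq; exact: (measurableT_comp mq). Qed.

Lemma Pi_R_section (p : policy R) u : Pi_R p -> measurable_fun setT (p u).
Proof.
move=> mp.
apply: (@measurableT_comp _ _ _ _ _ _ (fun z : R * history R => p z.1 z.2) _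
  (fun h => (u, h)) mp).
exact: measurable_fun_pair.
Qed.

Lemma measurable_final p : Pi_R p -> measurable_fun setT (final p).
Proof. by move=> mp; exact: measurable_final_history. Qed.

Let prod_setT : (U \x Q H)%E [set: R * Omega] = 1%E.
Proof.
rewrite -setXTT product_measure1E// -[RHS]mule1; congr (_ * _)%E.
  exact: probability_setT.
exact: probability_setT.
Qed.

Lemma integrable_final p : Pi_R p ->
  (U \x Q H)%E.-integrable setT (final p).
Proof.
move=> mp; have mF := measurable_final mp; apply/integrableP; split => //.
have mF1 : measurable_fun setT (fun z => `|final p z|%E).
  exact: measurableT_comp.
apply: le_lt_trans (lee_abs _) _.
apply: (le_lt_trans (y := (C%:E * 1)%E)); last by rewrite mule1 ltry.
rewrite -prod_setT; apply: abs_integral_le => //.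
by move=> z _; rewrite abse_id; exact: rewC.
Qed.

Lemma integrable_tau p t : Pi_R p -> Exp Q H (tau Y p H) = t%:E ->
  (U \x Q H)%E.-integrable setT (tau Y p H).
Proof.
move=> mp Et; apply/integrableP; split; first exact: measurable_tau.
apply: (le_lt_trans (y := Exp Q H (tau Y p H))); last by rewrite Et ltry.
rewrite le_eqVlt; apply/orP; left; apply/eqP; apply: eq_integral => z _.
by rewrite gee0_abs// tau_ge0.
Qed.

Lemma Exp_final_fin p : Pi_R p -> exists r : R, Exp Q H (final p) = r%:E.
Proof.
move=> /integrable_final /(integrable_fin_num measurableT) fE.
by exists (fine (Exp Q H (final p))); rewrite fineK.
Qed.

Lemma Exp_final_le p r : Pi_R p -> Exp Q H (final p) = r%:E -> `|r| <= C.
Proof.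
move=> mp Er; rewrite -lee_fin -abse_EFin -Er /Exp -[leRHS]mule1.
rewrite -prod_setT.
apply: abs_integral_le => //; first exact: measurable_final.
by move=> z _; exact: rewC.
Qed.

Lemma Exp_tau_section p u : Pi_R p ->
  Exp Q H (tau Y (fun=> p u) H) = (\int[Q H]_w tau Y p H (u, w))%E.
Proof.
move=> mp; have mu := deterministic_Pi_R (Pi_R_section u mp).
rewrite (Exp_section (u0 := u)); [|exact: measurable_tau|].
  by apply: eq_integral => w _; rewrite -tau_section.
by move=> u' w; exact: tau_section.
Qed.

Lemma Exp_final_section p u : Pi_R p ->
  Exp Q H (final (fun=> p u)) = (\int[Q H]_w final p (u, w))%E.
Proof.
move=> mp; have mu := deterministic_Pi_R (Pi_R_section u mp).
rewrite (Exp_section (u0 := u)); [|exact: measurable_final|].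
  by apply: eq_integral => w _; rewrite -final_section.
by move=> u' w; exact: final_section.
Qed.

(** Only finite mean sample numbers are recorded: a policy with an infinite one has performance
    [-oo] at every positive cost. *)
Definition attains (t r : R) := exists q : history R -> option (Rplus R),
  [/\ measurable_fun setT q, Exp Q H (tau Y (fun=> q) H) = t%:E &
      Exp Q H (final (fun=> q)) = r%:E].

(** Almost every section of [p] attains a point of its own, and the bound is integrated over [u].
    The signs of [al] and [be] are free, so that [al = 0] bounds the sample number alone. *)
Lemma linear_bound_Pi_R p (al be ga t r : R) :
  (forall t' r', attains t' r' -> al * r' + be * t' <= ga) ->
  Pi_R p -> Exp Q H (tau Y p H) = t%:E -> Exp Q H (final p) = r%:E ->
  al * r + be * t <= ga.
Proof.
move=> le_ga mp Et Er.
rewrite -lee_fin EFinD !EFinM -Et -Er /Exp; apply: fubini_linear_le.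
- exact: integrable_final.
- exact: (integrable_tau mp Et).
move=> u iF iT.
have mu := Pi_R_section u mp.
have ETu := Exp_tau_section u mp; have EFu := Exp_final_section u mp.
have /fineK ETf := integrable_fin_num measurableT iT.
have /fineK EFf := integrable_fin_num measurableT iF.
rewrite -[X in (_ + _ * X <= _)%E]ETf -[X in (_ * X + _ <= _)%E]EFf.
rewrite -!EFinM -EFinD lee_fin; apply: le_ga.
by exists (p u); split => //; rewrite ?ETf ?EFf.
Qed.

Lemma Exp_tau_finVinfty p :
  (exists t : R, 0 <= t /\ Exp Q H (tau Y p H) = t%:E) \/
  Exp Q H (tau Y p H) = +oo%E.
Proof.
have : (0 <= Exp Q H (tau Y p H))%E.
  by apply: integral_ge0 => z _; exact: tau_ge0.
case: (Exp Q H (tau Y p H)) => [t| |] // t0; [left|by right].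
by exists t; rewrite -lee_fin.
Qed.

Let payoff (p : policy R) (lam : R) (z : R * Omega) : \bar R :=
  (final p z - lam%:E * tau Y p H z)%E.

Lemma payoff_fin p lam t r : Pi_R p -> Exp Q H (tau Y p H) = t%:E ->
  Exp Q H (final p) = r%:E -> Exp Q H (payoff p lam) = (r - lam * t)%:E.
Proof.
move=> mp Et Er; have iT := integrable_tau mp Et.
have iF := integrable_final mp.
rewrite EFinB EFinM -Et -Er /Exp -integralZl//.
rewrite -[RHS]integralB//; exact: integrableZl.
Qed.

(** The positive part of the payoff is at most [C]. Were the integral of the negative part finite,
    the payoff would be integrable, and so would [lam * tau], its difference from the bounded
    reward. *)
Lemma payoff_infty p lam : 0 < lam -> Pi_R p ->
  Exp Q H (tau Y p H) = +oo%E -> Exp Q H (payoff p lam) = -oo%E.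
Proof.
move=> lam0 mp Et.
have mT : measurable_fun setT (tau Y p H) by exact: measurable_tau.
have mlT : measurable_fun setT (fun z => lam%:E * tau Y p H z)%E.
  exact: measurable_funeM.
have mP : measurable_fun setT (payoff p lam).
  by apply: emeasurable_funB => //; exact: measurable_final.
have posC z : ((payoff p lam)^\+%E z <= C%:E)%E.
  rewrite funeposE ge_max lee_fin C0 andbT /payoff.
  have := rewC (final_history Y p H z); rewrite abse_leE => /andP[_ FC].
  apply: le_trans FC; rewrite -/(final p z) geeDl// oppe_le0.
  by rewrite mule_ge0 ?lee_fin ?(ltW lam0)// tau_ge0.
have pos_lty : (Exp Q H (payoff p lam)^\+%E < +oo)%E.
  apply: (le_lt_trans (y := (C%:E * 1)%E)); last by rewrite mule1 ltry.
  apply: le_trans (lee_abs _) _; rewrite -prod_setT.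
  apply: abs_integral_le => //; first exact: measurable_funepos.
  by move=> z _; rewrite gee0_abs.
have [negE|neg_lty] := eqVneq (Exp Q H (payoff p lam)^\-%E) +oo%E.
  rewrite /Exp integralE -/(Exp Q H (payoff p lam)^\-%E) negE.
  by rewrite -/(Exp Q H (payoff p lam)^\+%E); case: (Exp _ _ _) pos_lty.
exfalso.
have iP : (U \x Q H)%E.-integrable setT (payoff p lam).
  apply/integrableP; split => //.
  rewrite -[X in integral _ _ X]/(abse \o payoff p lam) fune_abse.
  rewrite ge0_integralD//; [|exact: measurable_funepos|
    exact: measurable_funeneg].
  by apply: lte_add_pinfty => //; rewrite ltey.
have iT : (U \x Q H)%E.-integrable setT (fun z => lam%:E * tau Y p H z)%E.
  apply: eq_integrable (integrableB measurableT (integrable_final mp) iP) => //.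
  move=> z _; rewrite /payoff /=.
  (* Cancelling the reward in [final - (final - lam * tau)] needs it finite, whereas [tau] may be
     [+oo]. *)
  have /fineK <- : final p z \is a fin_num.
    have := rewC (final_history Y p H z).
    by rewrite -/(final p z); case: (final p z) => //=; rewrite leye_eq.
  case: (tau Y p H z) (tau_ge0 p z) => [s| |] //= _.
    by rewrite -!(EFinM, EFinN, EFinD) subKr.
  by rewrite mulry gtr0_sg// mul1e.
have := integrable_fin_num measurableT iT.
rewrite ge0_integralZl//; last 2 first.
- by move=> z _; exact: tau_ge0.
- by rewrite lee_fin ltW.
by rewrite -/(Exp Q H (tau Y p H)) Et mulry gtr0_sg// mul1e.
Qed.

Lemma Exp_stop (q : history R -> option (Rplus R)) r :
  q H = None -> rew H = r%:E ->
  Exp Q H (tau Y (fun=> q) H) = 0%E /\ Exp Q H (final (fun=> q)) = r%:E.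
Proof.
move=> qN rH; have s0 z : stop_at Y (fun=> q) H 0 z by split.
split.
  rewrite /Exp (eq_integral (cst 0%E)) ?integral0//.
  by move=> z _; rewrite (tau_stop_at (s0 z)).
rewrite -[RHS]mule1 -prod_setT -integral_cst//; apply: eq_integral => z _.
rewrite /= -rH /final (final_history_stop_at (s0 z)) /=.
by rewrite history_of_enum.
Qed.

Lemma attains_stop r : rew H = r%:E -> attains 0 r.
Proof.
move=> rH; exists (fun=> None); have [] := Exp_stop (q := fun=> None) erefl rH.
by split=> //; exact: measurable_cst.
Qed.

Lemma attains_ge0 t r : attains t r -> 0 <= t.
Proof.
move=> [q [mq Et _]]; rewrite -lee_fin -Et.
by apply: integral_ge0 => z _; exact: tau_ge0.
Qed.

(* A deterministic policy either stops at once or has tau >= 1 surely. *)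
Lemma attains_le t r r0 : rew H = r0%:E -> attains t r ->
  r <= r0 + (C + C) * t.
Proof.
move=> rH At; have t0 := attains_ge0 At; have [q [mq Et Er]] := At.
have mp := deterministic_Pi_R mq.
have [qN|qN] := eqVneq (q H) None.
  have [_] := Exp_stop qN rH; rewrite Er => -[->].
  by rewrite lerDl mulr_ge0// addr_ge0.
have t1 : 1 <= t.
  rewrite -lee_fin -Et -[leLHS]mule1 -prod_setT -integral_cst//.
  apply: ge0_le_integral => //; first exact: measurable_tau.
  move=> z _; rewrite /cst prod_setT; apply: le_ereal_inf_tmp => _ [n sn <-].
  rewrite lee_fin ler1n.
  by case: n sn => // /eqP; rewrite /stops/= (negbTE qN).
have rC := Exp_final_le mp Er.
have r0C : `|r0| <= C by rewrite -lee_fin -abse_EFin -rH.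
rewrite (le_trans (ler_norm r))// (le_trans rC)//.
(* Rewards lie between [-C] and [C], so [C + C] covers any gain over [r0] as soon as [t] is at least
   1. *)
have : (C + C) * 1 <= (C + C) * t by rewrite ler_wpM2l// addr_ge0.
by move: r0C; rewrite ler_norml mulr1 => /andP[? _] ?; lra.
Qed.

(** * Mixtures of two deterministic policies *)

(** Mixtures test [u < th] for every real [u], hence the half-line; the uniform law sees only its
    part in the unit interval. *)
Lemma uniform_prob_itvNyo (th : R) : 0 <= th <= 1 ->
  U [set` `]-oo, th[] = th%:E.
Proof.
move=> /andP[th0 th1].
have mA : measurable ([set` `]-oo, th[] : set (measurableTypeR R)) by [].
transitivity (\int[U]_u (\1_[set` `]-oo, th[] u)%:E)%E.
  by rewrite integral_indic// setIT.
rewrite integral_uniform//; last first.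
  by apply/measurable_EFinP; exact: measurable_indic.
rewrite subr0 invr1 mul1e integral_indic//.
rewrite (_ : [set` `]-oo, th[] `&` [set` `[0, 1]] = [set` `[0, th[]);
  last first.
  apply/seteqP; split => x /=; rewrite !in_itv/=.
    by move=> [-> /andP[-> _]].
  by move=> /andP[-> xth]; split => //; rewrite (ltW (lt_le_trans xth th1)).
rewrite /= lebesgue_measure_itv/= lte_fin sube0.
by case: ltP => // th_le0; apply/eqP; rewrite eqe eq_le th0 th_le0.
Qed.

Lemma integral_uniform_if (th x1 x2 : R) : 0 <= th <= 1 ->
  (\int[U]_u (if (u < th)%R then x1%:E else x2%:E) =
   (th * x1 + (1 - th) * x2)%:E)%E.
Proof.
move=> th01.
have mA : measurable ([set` `]-oo, th[] : set (measurableTypeR R)) by [].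
transitivity (\int[U]_u (x2%:E +
    (x1 - x2)%:E * (\1_[set` `]-oo, th[] u)%:E))%E.
  apply: eq_integral => u _; rewrite indicE; case: ifPn => uth.
    by rewrite mem_set/= ?in_itv//= mule1 -EFinD addrC subrK.
  by rewrite memNset/= ?mule0 ?adde0// in_itv/=; exact/negP.
have i1 := finite_measure_integrable_cst U x2 (@measurableT _ _).
have i2 : U.-integrable setT (fun u => (\1_[set` `]-oo, th[] u)%:E).
  exact: integrable_indic.
rewrite integralD//; last exact: integrableZl.
rewrite integralZl// integral_indic// setIT.
rewrite [X in (_ * X)%E](uniform_prob_itvNyo th01).
rewrite [X in (X + _)%E](integral_cst_prob U x2%:E) -EFinM -EFinD.
by congr _%:E; lra.
Qed.

(** For fixed [u] the inner integral is the mean of one of the two policies, so the outer integrand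
    takes two values. *)
Lemma mixture (th t1 r1 t2 r2 : R) : 0 <= th <= 1 ->
  attains t1 r1 -> attains t2 r2 -> exists p : policy R,
  [/\ Pi_R p, Exp Q H (tau Y p H) = (th * t1 + (1 - th) * t2)%:E &
      Exp Q H (final p) = (th * r1 + (1 - th) * r2)%:E].
Proof.
move=> th01 [q1 [mq1 Et1 Er1]] [q2 [mq2 Et2 Er2]].
pose p : policy R := fun u => if u < th then q1 else q2.
have mp : Pi_R p.
  rewrite /Pi_R/= (_ : (fun z => _) =
      (fun z : R * history R => if z.1 < th then q1 z.2 else q2 z.2)).
    apply: measurable_fun_ifT; [exact: measurable_fun_ltr| |];
      exact: measurableT_comp.
  by apply/funext => z; rewrite /p; case: ifP.
exists p; split => //.
- rewrite /Exp fubini_tonelli1//; [|exact: measurable_tau|exact: tau_ge0].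
  rewrite -integral_uniform_if//; apply: eq_integral => u _.
  by rewrite /fubini_F -Exp_tau_section// /p; case: ifP.
- rewrite /Exp -integral12_prod_meas1//; last exact: integrable_final.
  rewrite -integral_uniform_if//; apply: eq_integral => u _.
  by rewrite /fubini_F -Exp_final_section// /p; case: ifP.
Qed.

End performance.

(** * A supporting line for a set of points in the plane *)

(* The multiplier is the largest slope of a chord from (T, G) to the points of
   [D] beyond T, unless that slope is below [lam0], when [lam0] itself works. *)
Lemma concave_duality (R : realType) (D : R -> R -> Prop) (T G K r0 lam0 : R) :
  0 <= T -> 0 < lam0 -> D 0 r0 ->
  (forall t r, D t r -> 0 <= t) ->
  (forall t r, D t r -> r <= r0 + K * t) ->
  (forall th t1 r1 t2 r2, 0 <= th <= 1 -> D t1 r1 -> D t2 r2 ->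
     th * t1 + (1 - th) * t2 = T -> th * r1 + (1 - th) * r2 <= G) ->
  (exists t r, D t r /\ T < t) ->
  (forall lam, lam < lam0 ->
     (forall t r, D t r -> r <= G + lam * (t - T)) ->
     forall t r, D t r -> r <= G + lam0 * (t - T)) ->
  exists2 lam, 0 < lam & forall t r, D t r -> r <= G + lam * (t - T).
Proof.
move=> T0 lam00 D0 D_ge0 D_le mix [tR [rR [DR TtR]]] steep.
have atT r : D T r -> r <= G.
  move=> Dr; have := mix 1 T r T r _ Dr Dr.
  by rewrite ler01 lexx subrr !mul0r !addr0 !mul1r; exact.
(* The segment joining a point before [T] to one beyond passes below [G] at [T]; this compares the
   slopes of its ends seen from [(T, G)]. *)
have chord t1 r1 t2 r2 : D t1 r1 -> D t2 r2 -> t1 < T -> T < t2 ->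
    (r2 - G) / (t2 - T) <= (G - r1) / (T - t1).
  move=> D1 D2 t1T Tt2; have t12 := lt_trans t1T Tt2.
  have p1 : 0 < T - t1 by rewrite subr_gt0.
  have p2 : 0 < t2 - T by rewrite subr_gt0.
  have p12 : 0 < t2 - t1 by rewrite subr_gt0.
  (* This weight puts the mixture at abscissa [T]. *)
  pose th := (t2 - T) / (t2 - t1).
  have thE : th * (t2 - t1) = t2 - T by rewrite divfK// gt_eqF.
  have th01 : 0 <= th <= 1.
    apply/andP; split; first by rewrite divr_ge0 ?ltW.
    by rewrite /th ler_pdivrMr// mul1r; lra.
  have thT : th * t1 + (1 - th) * t2 = T by lra.
  have /(ler_wpM2r (ltW p12)) le_G := mix _ _ _ _ _ th01 D1 D2 thT.
  rewrite ler_pdivrMr// mulrAC ler_pdivlMr//.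
  have : th * (t2 - t1) * (r1 - r2) = (t2 - T) * (r1 - r2) by rewrite thE.
  by lra.
pose S := [set s | exists t r, [/\ D t r, T < t & s = (r - G) / (t - T)]].
have S_ub t r : D t r -> t < T -> ubound S ((G - r) / (T - t)).
  by move=> Dt tT _ [t2 [r2 [D2 Tt2 ->]]]; exact: chord.
have S_sup : has_sup S.
  split; first by exists ((rR - G) / (tR - T)), tR, rR.
  (* If [T] is positive, the point at abscissa 0 bounds all slopes in [S]. If [T = 0] no point lies
     before it, and the growth bound [K] takes over. *)
  have [T_gt0|T_le0] := ltP 0 T; first by eexists; exact: (S_ub _ _ D0 T_gt0).
  have TE : T = 0 by apply/eqP; rewrite eq_le T0 T_le0.
  have r0G : r0 <= G by apply: atT; rewrite TE.
  exists K => _ [t [r [Dt Tt ->]]].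
  rewrite ler_pdivrMr ?subr_gt0//.
  by have := D_le _ _ Dt; rewrite TE subr0; lra.
have below t r : D t r -> r <= G + sup S * (t - T).
  move=> Dt; have [tT|Tt|tE] := ltgtP t T.
  - have : sup S <= (G - r) / (T - t).
      by apply: ge_sup; [case: S_sup|exact: S_ub].
    by rewrite ler_pdivlMr ?subr_gt0//; lra.
  - have : (r - G) / (t - T) <= sup S.
      by apply: ub_le_sup; [case: S_sup|exists t, r].
    by rewrite ler_pdivrMr ?subr_gt0//; lra.
  - by rewrite tE subrr mulr0 addr0; apply: atT; rewrite -tE.
have [lt0|le0] := ltP (sup S) lam0.
  by exists lam0 => //; exact: (steep _ lt0 below).
by exists (sup S) => //; exact: lt_le_trans le0.
Qed.

(** This unpacks both limits in [Tbar]; the bound [e0] allows an arbitrarily small tolerance. *)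
Lemma lim_right_gt (R : realType) (F : R -> \bar R) (x e0 : R) :
  0 <= x -> 0 < e0 -> (x%:E < lim (F e @[e --> 0^'+]))%E ->
  exists e, [/\ 0 < e, e < e0 & (x%:E < F e)%E].
Proof.
(* If the limit does not exist, [lim] is the default value 0 of \bar R. *)
move=> x0 e00; rewrite /lim /lim_in; case: xgetP => [l _ Fl xl|_]; last first.
  by rewrite lte_fin ltNge x0.
have near_gt : \forall e \near (0 : R)^'+, (x%:E < F e)%E.
  exact: (Fl _ (open_ereal_gt' xl)).
have [e [[e_gt0 ee0] xFe]] := @filter_ex _ _ _ _
  (filterI (filterI (nbhs_right_gt (0 : R)) (nbhs_right_lt e00)) near_gt).
by exists e.
Qed.

(** * The cost-per-sample value as a real supremum *)

Section value.
Context (R : realType) (d : measure_display) (Omega : measurableType d).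
Variables (Y : Rplus R -> Omega -> R) (Q : history R -> probability Omega R).
Variables (a b : R) (I : finType) (f : I -> R -> R) (H : history R) (C : R).
Hypothesis mY : measurable_process Y.
Hypothesis mrew : measurable_fun setT (reward Y Q f a b).
Hypothesis C0 : 0 <= C.
Hypothesis rewC : forall h, (`|reward Y Q f a b h| <= C%:E)%E.

Let att := attains Y Q (reward Y Q f a b) H.

(** Policies with infinite mean sample number contribute [-oo], so [V] is the least upper bound of
    [r - lam * t] over attained points. It is at most [C], and stopping at once bounds it below. *)
Lemma V_fin lam : 0 < lam -> exists v : R,
  [/\ V Y Q f a b H lam = v%:E,
      (forall t r, att t r -> r - lam * t <= v) &
      (forall m, (forall t r, att t r -> r - lam * t <= m) -> v <= m)].
Proof.
move=> lam0.
have /fineK rH : reward Y Q f a b H \is a fin_num.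
  by have := rewC H; case: (reward _ _ _ _ _ _) => //=; rewrite leye_eq.
have V_ge t r : att t r -> ((r - lam * t)%:E <= V Y Q f a b H lam)%E.
  move=> [q [mq Et Er]]; apply: ereal_sup_ubound; exists (fun=> q).
    by exists q.
  exact: (payoff_fin mY mrew rewC lam (deterministic_Pi_R mq) Et Er).
have V_le m : (forall t r, att t r -> r - lam * t <= m) ->
    (V Y Q f a b H lam <= m%:E)%E.
  move=> le_m; apply: ge_ereal_sup => _ [_ [q mq ->] <-].
  have mp := deterministic_Pi_R mq.
  have [r Er] := Exp_final_fin Q H mY mrew rewC mp.
  have [[t [t0 Et]]|Et] := Exp_tau_finVinfty Y Q H (fun=> q).
    rewrite /Per (payoff_fin mY mrew rewC lam mp Et Er) lee_fin.
    by apply: le_m; exists q.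
  by rewrite /Per (payoff_infty mY mrew C0 rewC lam0 mp Et) leNye.
have VC : (V Y Q f a b H lam <= C%:E)%E.
  apply: V_le => t r Atr; have t0 := attains_ge0 Atr.
  have [q [mq _ Er]] := Atr.
  have := Exp_final_le mY mrew rewC (deterministic_Pi_R mq) Er.
  rewrite ler_norml => /andP[_ rC]; rewrite (le_trans _ rC)// gerDl oppr_le0.
  exact: mulr_ge0 (ltW lam0) t0.
have V_fin : V Y Q f a b H lam \is a fin_num.
  rewrite fin_numE; apply/andP; split; apply/eqP => VE.
    by have := V_ge _ _ (attains_stop Y Q (esym rH)); rewrite VE.
  by move: VC; rewrite VE.
exists (fine (V Y Q f a b H lam)); split; first by rewrite fineK.
- by move=> t r /V_ge; rewrite -[X in (_ <= X)%E]fineK.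
- by move=> m /V_le; rewrite -[X in (X <= _)%E]fineK.
Qed.

End value.

(** * Weak and strong duality *)

Theorem theorem5 (R : realType) (d : measure_display)
    (Omega : measurableType d) (P : probability Omega R)
    (Y : Rplus R -> Omega -> R) (Q : history R -> probability Omega R)
    (a b : R) (I : finType) (f : I -> R -> R) (H0 : history R) (T : R)
    (Ymeas : measurable_process Y)
    (Ymarkov : markov_process P Y)
    (Qcond : conditional_laws P Y Q)
    (a_gt0 : 0 < a) (ab : a < b)
    (I_neq0 : (0 < #|I|)%N)
    (fmeas : forall i, measurable_fun setT (f i))
    (fbounded : forall i, exists M : R, forall y, `|f i y| <= M)
    (fintegrable : forall i,
      (\int[lebesgue_measure]_(x in `[a, b])
         'E_P[fun w => `|f i (Y (to_Rplus x) w)|%R] < +oo)%E)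
    (T_ge0 : 0 <= T) (TltTbar : (T%:E < Tbar Y Q f a b H0)%E) :
  V1 Y Q f a b H0 T =
  ereal_inf [set (V Y Q f a b H0 lambda + (lambda * T)%:E)%E
            | lambda in [set lambda : R | 0 < lambda]].
Proof.
have mrew : measurable_fun setT (reward Y Q f a b).
  exact: (measurable_reward a b Ymeas (cond_measurable Qcond) fmeas).
have [C C0 rewC] := reward_bounded Ymeas (cond_measurable Qcond) ab I_neq0
  fmeas fbounded.
pose att := attains Y Q (reward Y Q f a b) H0.
have [r0 rH] : exists r0, reward Y Q f a b H0 = r0%:E.
  exists (fine (reward Y Q f a b H0)); rewrite fineK//.
  by have := rewC H0; case: (reward _ _ _ _ _ _) => //=; rewrite leye_eq.
have VP (lam : R) (lam0 : 0 < lam) := V_fin H0 Ymeas mrew C0 rewC lam0.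
have linear := linear_bound_Pi_R Ymeas mrew rewC (H := H0) (Q := Q).
have finalP p (mp : Pi_R p) := Exp_final_fin Q H0 Ymeas mrew rewC mp.
have [lam0 [lam00 _ sT]] := lim_right_gt T_ge0 ltr01 TltTbar.
have [v0 [Vv0 v0_ge v0_le]] := VP _ lam00.
have near_opt (e : R) : 0 < e -> exists p t r, [/\ Pi_R p,
    Exp Q H0 (tau Y p H0) = t%:E,
    Exp Q H0 (fun z => reward Y Q f a b (final_history Y p H0 z)) = r%:E,
    T < t & v0 - e <= r - lam0 * t].
  move=> e0; have [e' [e'0 e'e]] := lim_right_gt T_ge0 e0 sT.
  move=> /ereal_sup_gt[_ [p [mp /(_ H0) opt] <-] Tt].
  have [r Er] := finalP p mp.
  (* An infinite mean sample number would make the performance [-oo], contradicting near-optimality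
     because [v0] is finite. *)
  have [[t [t0 Et]]|Et] := Exp_tau_finVinfty Y Q H0 p; last first.
    move: opt; rewrite /Per (payoff_infty Ymeas mrew C0 rewC lam00 mp Et).
    by rewrite Vv0.
  exists p, t, r; split => //; first by move: Tt; rewrite Et lte_fin.
  move: opt; rewrite /Per (payoff_fin Ymeas mrew rewC lam0 mp Et Er) Vv0.
  by rewrite lee_fin; lra.
have [tR [rR [DR TtR]]] : exists t r, att t r /\ T < t.
  (* The policies from [near_opt] may be randomized. If no deterministic point lay beyond [T], the
     linear bound with coefficients 0 and 1 would force [t <= T] for them too. *)
  apply: contrapT => nright.
  have [p [t [r [mp Et Er Tt _]]]] := near_opt 1 ltr01.
  have : 0 * r + 1 * t <= T.
    apply: linear mp Et Er => t' r' D'; rewrite mul0r mul1r add0r leNgt.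
    by apply/negP => Tt'; apply: nright; exists t', r'.
  by rewrite mul0r mul1r add0r leNgt Tt.
have D0 : att 0 r0 by exact: attains_stop.
have V1_ge (th t1 r1 t2 r2 : R) : 0 <= th <= 1 -> att t1 r1 -> att t2 r2 ->
    th * t1 + (1 - th) * t2 = T ->
    ((th * r1 + (1 - th) * r2)%:E <= V1 Y Q f a b H0 T)%E.
  move=> th01 D1 D2 thT.
  have [p [mp Et Er]] := mixture Ymeas mrew rewC th01 D1 D2.
  by rewrite -Er; apply: ereal_sup_ubound; exists p => //; split;
    rewrite //= Et thT.
have V1_fin : V1 Y Q f a b H0 T \is a fin_num.
  have tR0 : 0 < tR by exact: le_lt_trans TtR.
  (* Mixing the point beyond [T] with immediate stopping in this proportion spends exactly [T], so
     [V1] is not [-oo]. *)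
  have th01 : 0 <= T / tR <= 1.
    apply/andP; split; first by rewrite divr_ge0// ltW.
    by rewrite ler_pdivrMr// mul1r ltW.
  have := V1_ge _ _ _ _ _ th01 DR D0.
  rewrite mulr0 addr0 divfK ?gt_eqF// => /(_ erefl) V1_gt.
  rewrite fin_numE; apply/andP; split; apply/eqP => VE.
    by move: V1_gt; rewrite VE.
  suff : (V1 Y Q f a b H0 T <= C%:E)%E by rewrite VE.
  apply: ge_ereal_sup => _ [p [mp Et] <-]; have [r Er] := finalP p mp.
  rewrite Er lee_fin (le_trans (ler_norm _))//.
  exact: (Exp_final_le Ymeas mrew rewC mp Er).
have [lam lam_gt0 below] : exists2 lam, 0 < lam &
    forall t r, att t r -> r <= fine (V1 Y Q f a b H0 T) + lam * (t - T).
  apply: (concave_duality (K := C + C) (r0 := r0) T_ge0 lam00) => //.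
  - by move=> t r; exact: attains_ge0.
  - by move=> t r; exact: (attains_le Ymeas mrew C0 rewC rH).
  - move=> th t1 r1 t2 r2 th01 D1 D2 thT.
    by rewrite -lee_fin fineK//; exact: V1_ge D1 D2 thT.
  - by exists tR, rR.
  - move=> lam lam_lt below t r /v0_ge v0_ge_tr.
    set G := fine _ in below *.
    suff : v0 <= G - lam0 * T by lra.
    apply/ler_addgt0Pr => e e0.
    have [p [tp [rp [mp Et Er Tt opt]]]] := near_opt e e0.
    have : 1 * rp + - lam * tp <= G - lam * T.
      by apply: linear mp Et Er => t' r' /below; lra.
    (* As [tp] exceeds [T], raising the slope from [lam] to [lam0] only weakens the bound on [rp],
       whence [v0 - e <= G - lam0 * T]. *)
    have : 0 <= (lam0 - lam) * (tp - T) by rewrite mulr_ge0 ?subr_ge0 ?ltW.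
    by lra.
apply/eqP; rewrite eq_le; apply/andP; split.
  (* Weak duality: the linear bound with coefficients 1 and [- mu]. *)
  apply: ge_ereal_sup => _ [p [mp Et] <-].
  apply: le_ereal_inf_tmp => _ [mu mu0 <-].
  have [v [-> v_ge _]] := VP _ mu0; have [r Er] := finalP p mp.
  rewrite Er -EFinD lee_fin.
  have : 1 * r + - mu * T <= v.
    by apply: linear mp Et Er => t' r' /v_ge; lra.
  by lra.
(* Strong duality: the supporting slope [lam] alone brings the infimum down to [V1]. *)
apply: ge_ereal_inf.
exists (V Y Q f a b H0 lam + (lam * T)%:E)%E; first by exists lam.
have [v [-> _ v_le]] := VP _ lam_gt0.
rewrite -[leRHS]fineK// -EFinD lee_fin.
suff : v <= fine (V1 Y Q f a b H0 T) - lam * T by lra.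
by apply: v_le => t r /below; lra.
Qed.
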